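(* (Implicative Visser's rules for $\mathsf{iK_d}$) Let $I$ and $J$ be finite sets (possibly empty), let $\{m_i\}_{i \in I}$ and $\{n_j\}_{j \in J}$ be sequences of natural numbers, let $k$ be a natural number, and let $A_i,B_i$ ($i\in I$), $C_j,D_j$ ($j\in J$), $E$, $F$ be formulas. If $$\mathsf{iK_d} \vdash \Big[\bigwedge_{i \in I} \nabla^{m_i}(A_i \supset B_i) \wedge \bigwedge_{j \in J} \nabla^{n_j} (C_j \rightarrow D_j)\Big] \rightarrow \nabla^k(E \to F),$$ then one of the following holds: - $\mathsf{iK_d} \vdash [\bigwedge_{i \in I} \nabla^{m_i}(A_i \supset B_i) \wedge \bigwedge_{j \in J} \nabla^{n_j} (C_j \rightarrow D_j)] \rightarrow \nabla^{m_{i_0}} A_{i_0}$, for some $i_0 \in I$; - $\mathsf{iK_d} \vdash [\bigwedge_{i \in I} \nabla^{m_i}(A_i \supset B_i) \wedge \bigwedge_{j \in J} \nabla^{n_j} (C_j \rightarrow D_j)] \rightarrow \nabla^{n_{j_0}-1} C_{j_0}$, for some $j_0 \in J$ with $n_{j_0} \geq 1$; - $\mathsf{iK_d} \vdash [\bigwedge_{i \in I'} \nabla^{m_i-k+1}(A_i \supset B_i) \wedge \bigwedge_{j \in J'} \nabla^{n_j-k+1} (C_j \rightarrow D_j) \wedge E] \rightarrow F$, for some $I' \subseteq I$ and $J' \subseteq J$ such that $m_i, n_j \geq k$ for all $i \in I'$ and $j \in J'$.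
   Context: Language and sequents. Fix a set $V$ of atomic propositions. $\mathcal{L}$-formulas (simply ''formulas'') are built from atoms in $V$ and the constants $\top,\bot$ using binary connectives $\wedge,\vee,\supset,\to$ and the unary connective $\nabla$. $\nabla^n A$ is the $n$-fold application of $\nabla$ to $A$, and $\nabla\Gamma=\{\nabla A \mid A\in\Gamma\}$ as a multiset. $\bigwedge$ denotes finite iterated conjunction, with the empty conjunction equal to $\top$. Natural numbers include $0$. A sequent is an expression $\Gamma\Rightarrow\Delta$ with $\Gamma,\Delta$ finite multisets of formulas, $\Delta$ containing at most one formula. Comma is multiset union; a formula stands for its singleton. Calculus $\mathbf{STL(N,H)}$ (over $\mathcal{L}$). Rules are written ''premises / conclusion''; $\Gamma,\Sigma$ are arbitrary finite multisets, $\Delta$ has at most one formula, $A,B$ are arbitrary formulas. Axioms: $(Id)$ $A\Rightarrow A$; $(L\bot)$ $\bot\Rightarrow$; $(R\top)$ $\Rightarrow\top$. $(Lw)$ $\Gamma\Rightarrow\Delta$ / $\Gamma,A\Rightarrow\Delta$. $(Rw)$ $\Gamma\Rightarrow$ / $\Gamma\Rightarrow A$. $(Lc)$ $\Gamma,A,A\Rightarrow\Delta$ / $\Gamma,A\Rightarrow\Delta$. $(cut)$ $\Gamma\Rightarrow A$ and $\Sigma,A\Rightarrow\Delta$ / $\Sigma,\Gamma\Rightarrow\Delta$. $(L\wedge_1)$ $\Gamma,A\Rightarrow\Delta$ / $\Gamma,A\wedge B\Rightarrow\Delta$. $(L\wedge_2)$ $\Gamma,B\Rightarrow\Delta$ /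 $\Gamma,A\wedge B\Rightarrow\Delta$. $(R\wedge)$ $\Gamma\Rightarrow A$ and $\Gamma\Rightarrow B$ / $\Gamma\Rightarrow A\wedge B$. $(L\vee)$ $\Gamma,A\Rightarrow\Delta$ and $\Gamma,B\Rightarrow\Delta$ / $\Gamma,A\vee B\Rightarrow\Delta$. $(R\vee_1)$ $\Gamma\Rightarrow A$ / $\Gamma\Rightarrow A\vee B$. $(R\vee_2)$ $\Gamma\Rightarrow B$ / $\Gamma\Rightarrow A\vee B$. $(N)$ $\Gamma\Rightarrow\Delta$ / $\nabla\Gamma\Rightarrow\nabla\Delta$. $(L\to)$ $\Gamma\Rightarrow A$ and $\Gamma,B\Rightarrow\Delta$ / $\Gamma,\nabla(A\to B)\Rightarrow\Delta$. $(R\to)$ $\nabla\Gamma,A\Rightarrow B$ / $\Gamma\Rightarrow A\to B$. $(L\supset)$ $\Gamma\Rightarrow A$ and $\Gamma,B\Rightarrow\Delta$ / $\Gamma,A\supset B\Rightarrow\Delta$. $(R\supset)$ $\Gamma,A\Rightarrow B$ / $\Gamma\Rightarrow A\supset B$. The logic $\mathsf{iK_d}$ is the set of formulas $A$ such that $\Rightarrow A$ has a proof-tree in $\mathbf{STL(N,H)}$; $\mathsf{iK_d}\vdash A$ means $A\in\mathsf{iK_d}$. *)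

(* Defs.v *)
From mathcomp Require Import all_boot.
From Stdlib Require Import Permutation.

Set Implicit Arguments.
Unset Strict Implicit.
Unset Printing Implicit Defensive.

(** [Imp] is the Heyting implication (a horseshoe on paper); [Arr] is the
    temporal implication, written with a plain arrow. *)
Inductive form (V : Type) : Type :=
| Atom of V
| Top
| Bot
| Conj of form V & form V
| Disj of form V & form V
| Imp of form V & form V
| Arr of form V & form V
| Nabla of form V.

Arguments Top {V}.
Arguments Bot {V}.

(** The calculus STL(N,H).  [stl G D] says that the sequent with antecedent [G]
    and succedent [D] has a proof-tree.  Antecedents are finite multisets,
    encoded as lists modulo the exchange rule [stl_perm]; a succedent holds at
    most one formula, whence the [option]. *)
Inductive stl (V : Type) : seq (form V) -> option (form V) -> Prop :=
| stl_perm G G' D : Permutation G G' -> stl G D -> stl G' D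
| stl_id A : stl [:: A] (Some A)
| stl_Lbot : stl [:: Bot] None
| stl_Rtop : stl [::] (Some Top)
| stl_Lw G A D : stl G D -> stl (A :: G) D
| stl_Rw G A : stl G None -> stl G (Some A)
| stl_Lc G A D : stl (A :: A :: G) D -> stl (A :: G) D
| stl_cut G S A D : stl G (Some A) -> stl (A :: S) D -> stl (S ++ G) D
| stl_Lconj1 G A B D : stl (A :: G) D -> stl (Conj A B :: G) D
| stl_Lconj2 G A B D : stl (B :: G) D -> stl (Conj A B :: G) D
| stl_Rconj G A B :
    stl G (Some A) -> stl G (Some B) -> stl G (Some (Conj A B))
| stl_Ldisj G A B D :
    stl (A :: G) D -> stl (B :: G) D -> stl (Disj A B :: G) D
| stl_Rdisj1 G A B : stl G (Some A) -> stl G (Some (Disj A B))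
| stl_Rdisj2 G A B : stl G (Some B) -> stl G (Some (Disj A B))
| stl_N G D : stl G D -> stl (map (@Nabla V) G) (omap (@Nabla V) D)
| stl_Larr G A B D :
    stl G (Some A) -> stl (B :: G) D -> stl (Nabla (Arr A B) :: G) D
| stl_Rarr G A B :
    stl (A :: map (@Nabla V) G) (Some B) -> stl G (Some (Arr A B))
| stl_Limp G A B D :
    stl G (Some A) -> stl (B :: G) D -> stl (Imp A B :: G) D
| stl_Rimp G A B : stl (A :: G) (Some B) -> stl G (Some (Imp A B)).

Definition iKd (V : Type) (A : form V) : Prop := stl [::] (Some A).

Definition nabla_iter (V : Type) (n : nat) (A : form V) : form V :=
  iter n (@Nabla V) A.

(* Main.v *)
Require Import Defs.
From Stdlib Require Import Permutation List Classical.
From mathcomp Require Import all_boot.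

Set Implicit Arguments.
Unset Strict Implicit.
Unset Printing Implicit Defensive.

(** The proof is a Kleene-Aczel slash argument, the syntactic form of glueing a
    fresh part below a Kripke model.

    In a Kripke model of this logic the time shift is a monotone map [f]; a
    point [w] forces [Nabla A] when [f w] forces [A], and forces [Arr A B] when
    every [y] with [w <= f y] that forces [A] also forces [B].  Suppose that the
    first two alternatives fail.  Add a chain of new points [r 0, r 1, ...], with
    [f (r t) = r t.+1] and no order between distinct points of the chain.  Above
    [r t] place the [t]-th shifts of all models of [X] and, when [k <= t], the
    [(t - k + 1)]-st shifts of all models of [Y], where [Y] is the antecedent of
    the third alternative.  The placed points satisfy what [r 0] needs to force
    [X], by the choice of [X] and [Y]; on the chain itself,
    - [r (m i)] cannot force [A i], since [X] does not entail the [m i]-fold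
      [Nabla] of [A i], so that [Imp (A i) (B i)] puts no demand on it;
    - the only point of the chain sent to [r (n j)] by [f] is [r (n j - 1)],
      which exists only for [0 < n j] and cannot force [C j], since [X] does not
      entail the [(n j - 1)]-fold [Nabla] of [C j].
    Hence [r k] forces [Arr E F].  As [r k] lies below the first shift of every
    model of [Y], it follows that [Y] entails [Nabla (Arr E F)]; but [Y] entails
    [E], so it entails [F].

    Models are never needed: what holds everywhere strictly above [r t] is a
    deductively closed set [T t] of formulas, and forcing at [r t] is defined
    from [T] by recursion on formulas ([slash]).  The two facts that carry the
    argument are [slash_theory] (what [r t] forces belongs to [T t]) and
    [slash_sound] (forcing at the [r t] is preserved by all the rules). *)

(** Cutting a whole antecedent against one formula; the copy of [X] kept in the
    premise collects what the successive cuts leave behind. *)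
Lemma stl_multicut (V : Type) (X : form V) (G : seq (form V)) D :
  Forall (fun B => stl [:: X] (Some B)) G -> stl (G ++ [:: X]) D ->
  stl [:: X] D.
Proof.
elim: G => [//|B G IH] /Forall_cons_iff [XB XG] GD; apply: IH => //.
have GXX : Permutation ((G ++ [:: X]) ++ [:: X]) (X :: X :: G).
  rewrite -catA; exact: Permutation_app_comm.
apply: (stl_perm (Permutation_sym (Permutation_app_comm G [:: X]))).
by apply/stl_Lc/(stl_perm GXX)/(stl_cut XB).
Qed.

Lemma stl_nabla_iter (V : Type) t (G : seq (form V)) (A : form V) :
  stl G (Some A) -> stl (map (nabla_iter t) G) (Some (nabla_iter t A)).
Proof.
move=> GA; elim: t => [|t IH] /=; first by rewrite map_id.
have -> : map (nabla_iter t.+1) G = map (@Nabla V) (map (nabla_iter t) G).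
  by rewrite -map_comp.
exact: (stl_N IH).
Qed.

Lemma iKd_arr (V : Type) (A B : form V) :
  iKd (Arr A B) <-> stl [:: A] (Some B).
Proof.
split=> [AB|AB]; last exact: stl_Rarr.
apply: (stl_cut (stl_N AB) (S := [:: A])) => /=.
exact: (stl_Larr (stl_id A) (stl_perm (perm_swap _ _ _) (stl_Lw A (stl_id B)))).
Qed.

Lemma stl_conj1 (V : Type) (A B C : form V) :
  stl [:: A] (Some C) -> stl [:: Conj A B] (Some C).
Proof. exact: stl_Lconj1. Qed.

Lemma stl_conj2 (V : Type) (A B C : form V) :
  stl [:: B] (Some C) -> stl [:: Conj A B] (Some C).
Proof. exact: stl_Lconj2. Qed.

Lemma stl_bigconj (V : Type) (I : finType) (P : pred I) (H : I -> form V) i :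
  P i -> stl [:: \big[@Conj V/Top]_(l | P l) H l] (Some (H i)).
Proof.
move=> Pi; have: i \in index_enum I by rewrite mem_index_enum.
elim: (index_enum I) => [//|l r IH]; rewrite inE big_cons.
case: eqP => [<- _|_ /= /IH ri]; first by rewrite Pi; exact/stl_conj1/stl_id.
by case: ifP => _ //; exact: stl_conj2.
Qed.

(** The formulas true at the [t]-th shift of every model of [X]. *)
Definition shifted_theory (V : Type) (X : form V) (t : nat) (A : form V) : Prop :=
  stl [:: X] (Some (nabla_iter t A)).

Definition stl_closed (V : Type) (T : form V -> Prop) : Prop :=
  forall G A, stl G (Some A) -> Forall T G -> T A.

(** This is where preservation of finite conjunctions by [Nabla], that is the
    rule [stl_N], enters. *)
Lemma shifted_theory_closed (V : Type) (X : form V) t :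
  stl_closed (shifted_theory X t).
Proof.
move=> G A /(@stl_nabla_iter _ t) GA XG.
apply: (stl_multicut (G := map (nabla_iter t) G)); first by apply/Forall_map.
exact: (stl_perm (Permutation_app_comm [:: X] _) (stl_Lw X GA)).
Qed.

Section Slash.

Variables (V : Type) (T : nat -> form V -> Prop).

(** Forcing at the point [r t] of a chain with [f (r t) = r t.+1], when [T t] is
    what holds strictly above [r t].  In the clause for [Arr], the points [y]
    with [r t <= f y] that lie on the chain are the predecessor of [r t], if
    any; all other such [y] are accounted for by membership in [T t]. *)
Fixpoint slash (A : form V) (t : nat) : Prop :=
  match A with
  | Atom _ => T t A
  | Top => True
  | Bot => False
  | Conj A1 A2 => slash A1 t /\ slash A2 t
  | Disj A1 A2 => slash A1 t \/ slash A2 t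
  | Imp A1 A2 => T t A /\ (slash A1 t -> slash A2 t)
  | Arr A1 A2 =>
      T t A /\ (if t is s.+1 then slash A1 s -> slash A2 s else True)
  | Nabla A1 => slash A1 t.+1
  end.

Lemma slash_nabla_iter n t A : slash (nabla_iter n A) t <-> slash A (n + t).
Proof. by elim: n t => [//|n IH] t; rewrite addSnnS; exact: (IH t.+1). Qed.

Hypothesis T_closed : forall t, stl_closed (T t).

(** The shift is monotone: it sends the points above [r t] above [r t.+1]. *)
Hypothesis T_nabla : forall t A, T t.+1 A -> T t (Nabla A).

Lemma slash_theory A t : slash A t -> T t A.
Proof.
have T1 B C s : stl [:: B] (Some C) -> T s B -> T s C.
  by move=> BC sB; apply: (T_closed BC); repeat constructor.
elim: A t => [p||| A IHA B IHB|A IHA B IHB|A _ B _|A _ B _|A IHA] t //=.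
- by move=> _; exact: (T_closed (stl_Rtop V) (Forall_nil _)).
- move=> [/IHA tA /IHB tB].
  apply: (@T_closed t [:: A; B]); last by repeat constructor.
  apply: stl_Rconj; last exact/stl_Lw/stl_id.
  exact: (stl_perm (perm_swap _ _ _) (stl_Lw B (stl_id A))).
- case=> [/IHA|/IHB]; apply: T1; first exact/stl_Rdisj1/stl_id.
  exact/stl_Rdisj2/stl_id.
- by case.
- by case.
- by move=> /IHA /T_nabla.
Qed.

Lemma slash_theories G t : Forall (slash^~ t) G -> Forall (T t) G.
Proof. by apply: Forall_impl => A; exact: slash_theory. Qed.

(** The chain has to be treated as a whole: to pass through [stl_N] at [r t] the
    premise is needed at [r t.+1], and to pass through [stl_Rarr] at [r t.+1] it
    is needed at [r t]. *)
Lemma slash_sound G D : stl G D ->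
  forall t, Forall (slash^~ t) G -> if D is Some A then slash A t else False.
Proof.
elim=> {G D}.
- by move=> G G' D GG' _ IH t /(Permutation_Forall (Permutation_sym GG')) /IH.
- by move=> A t /Forall_cons_iff [].
- by move=> t /Forall_cons_iff [].
- by [].
- by move=> G A D _ IH t /Forall_cons_iff [_ /IH].
- by move=> G A _ IH t /IH.
- by move=> G A D _ IH t /Forall_cons_iff [tA tG]; apply: IH; repeat constructor.
- move=> G S A D _ IHA _ IH t /Forall_app [tS /IHA tA].
  by apply: IH; constructor.
- by move=> G A B D _ IH t /Forall_cons_iff [[tA _] tG]; apply: IH; constructor.
- by move=> G A B D _ IH t /Forall_cons_iff [[_ tB] tG]; apply: IH; constructor.
- by move=> G A B _ IHA _ IHB t tG; split; [exact: IHA | exact: IHB].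
- move=> G A B D _ IHA _ IHB t /Forall_cons_iff [[tA|tB] tG].
    by apply: IHA; constructor.
  by apply: IHB; constructor.
- by move=> G A B _ IH t /IH; left.
- by move=> G A B _ IH t /IH; right.
- by move=> G [A|] _ IH t /Forall_map /(IH t.+1).
- move=> G A B D _ IHA _ IHB t /Forall_cons_iff [[_ tAB] tG].
  by apply: IHB; constructor=> //; apply/tAB/IHA.
- move=> G A B GAB IH t tG; split.
    exact: (T_closed (stl_Rarr GAB) (slash_theories tG)).
  case: t tG => [//|t] tG tA; apply: IH; constructor=> //.
  exact/Forall_map.
- move=> G A B D _ IHA _ IHB t /Forall_cons_iff [[_ tAB] tG].
  by apply: IHB; constructor=> //; apply/tAB/IHA.
- move=> G A B GAB IH t tG; split.
    exact: (T_closed (stl_Rimp GAB) (slash_theories tG)).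
  by move=> tA; apply: IH; constructor.
Qed.

End Slash.

(** What holds strictly above the [t]-th point of the chain when all models of
    [X] are placed above the point [0], and the first shifts of all models of
    [Y] above the point [k]. *)
Definition glued_theory (V : Type) (X Y : form V) (k t : nat) (A : form V) : Prop :=
  shifted_theory X t A /\ (k <= t -> shifted_theory Y (t - k + 1) A).

Lemma glued_theory_closed (V : Type) (X Y : form V) k t :
  stl_closed (glued_theory X Y k t).
Proof.
move=> G A GA tG; split=> [|kt]; apply: (shifted_theory_closed GA).
  by apply: Forall_impl tG => B [].
by apply: Forall_impl tG => B [_]; apply.
Qed.

Lemma glued_theory_nabla (V : Type) (X Y : form V) k t A :
  glued_theory X Y k t.+1 A -> glued_theory X Y k t (Nabla A).
Proof.
rewrite /glued_theory /shifted_theory => -[XA YA].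
have nablaSr s : nabla_iter s (Nabla A) = nabla_iter s.+1 A.
  by rewrite /nabla_iter iterSr.
rewrite nablaSr; split=> // kt.
by rewrite nablaSr -addSn -subSn //; apply/YA/leqW.
Qed.

Theorem theorem15 (V : Type) (I J : finType) (m : I -> nat) (n : J -> nat)
    (k : nat) (A B : I -> form V) (C D : J -> form V) (E F : form V) :
  let X : form V :=
    Conj (\big[@Conj V/Top]_(i : I) nabla_iter (m i) (Imp (A i) (B i)))
         (\big[@Conj V/Top]_(j : J) nabla_iter (n j) (Arr (C j) (D j))) in
  iKd (Arr X (nabla_iter k (Arr E F))) ->
  [\/ exists i0 : I, iKd (Arr X (nabla_iter (m i0) (A i0))),
      exists j0 : J,
        1 <= n j0 /\ iKd (Arr X (nabla_iter (n j0 - 1) (C j0)))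
    | exists (I' : {set I}) (J' : {set J}),
        [/\ (forall i, i \in I' -> k <= m i),
            (forall j, j \in J' -> k <= n j)
          & iKd (Arr
              (Conj
                (Conj
                  (\big[@Conj V/Top]_(i in I')
                     nabla_iter (m i - k + 1) (Imp (A i) (B i)))
                  (\big[@Conj V/Top]_(j in J')
                     nabla_iter (n j - k + 1) (Arr (C j) (D j))))
                E)
              F)]].
Proof.
move=> X /iKd_arr XEF.
case: (classic (exists i0 : I, iKd (Arr X (nabla_iter (m i0) (A i0))))) => [|noA].
  by constructor 1.
case: (classic (exists j0 : J,
    1 <= n j0 /\ iKd (Arr X (nabla_iter (n j0 - 1) (C j0))))) => [|noC].
  by constructor 2.
constructor 3; exists [set i | k <= m i], [set j | k <= n j].
split=> [i|j|]; rewrite ?inE //; apply/iKd_arr; set Y := Conj _ E.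
pose T := glued_theory X Y k.
have Tclosed : forall t, stl_closed (T t) := @glued_theory_closed V X Y k.
have Tnabla : forall t H, T t.+1 H -> T t (Nabla H) := @glued_theory_nabla V X Y k.
have slashX : slash T X 0.
  split; apply: (big_ind ((slash T)^~ 0)) => [//|P Q sP sQ|l _]; try by split.
    apply/slash_nabla_iter; rewrite addn0; split; last first.
      (* [slash T (A l) (m l)] would give the first alternative. *)
      move=> /(slash_theory Tclosed Tnabla) [XA _]; case: noA.
      by exists l; apply/iKd_arr.
    split=> [|kl].
      exact: (stl_conj1 _ (stl_bigconj (P := predT) _ _)).
    by apply/stl_conj1/stl_conj1; apply: stl_bigconj; rewrite inE.
  apply/slash_nabla_iter; rewrite addn0; split; last first.
    (* [C l] slashed at the predecessor of [n l] would give the second one. *)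
    case nl: (n l) => [//|s] /(slash_theory Tclosed Tnabla) [XC _]; case: noC.
    by exists l; rewrite nl subn1; split=> //; apply/iKd_arr.
  split=> [|kl].
    exact: (stl_conj2 _ (stl_bigconj (P := predT) _ _)).
  by apply/stl_conj1/stl_conj2; apply: stl_bigconj; rewrite inE.
have slashX1 : Forall ((slash T)^~ 0) [:: X] by apply: Forall_cons.
have /slash_nabla_iter := slash_sound Tclosed Tnabla XEF slashX1.
rewrite addn0 => /(slash_theory Tclosed Tnabla) [_ /(_ (leqnn k))].
rewrite subnn => YEF.
apply: (@shifted_theory_closed V Y 0 [:: Nabla (Arr E F); E]).
  exact: (stl_Larr (stl_id E) (stl_perm (perm_swap _ _ _) (stl_Lw E (stl_id F)))).
apply: Forall_cons => //; apply: Forall_cons => //; exact/stl_conj2/stl_id.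
Qed.
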